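(* Let $m\ge 3$ be a natural number such that there is a prime strictly between $(m-1)^2$ and $m^2$ (so that $k_1$ is defined). There exists a prime $p$ with $m^2<p<(m+1)^2$ (i.e. Legendre's conjecture holds for $m$) if and only if the active set $H_{(m-1)^4,\,m^4}$ is nonempty.
   Context: Let $p_i$ be the $i$-th prime ($p_1=2$). For $k\ge 1$ put $p(k)=p_{k+2}$, so $p(1)=5$, $p(2)=7$, etc. The $T$-matrix has entries $a(k;n)=p(k)\left(5+2\lfloor n/2\rfloor+4\lfloor (n-1)/2\rfloor\right)$, $k,n\ge 1$. An entry is called defining if it is not divisible by $5$ and is a product of two (not necessarily distinct) primes. For $m\ge 3$, $k_1$ is the index such that $p(k_1)$ is the largest $p(k)$ with $k>1$ and $(m-1)^2<p(k)<m^2$. For a defining element $a(k_1;n)>p(k_1)^2$ let $j$ be its transition row, i.e. the unique index with $k_1<j$, $a(k_1;n)<p(j)^2$, $a(j;r)=a(k_1;n)$ where $r$ is the column with $a(k_1;r)=p(k_1)^2$, and $a(j;n)=p(j)^2$ (such a unique $j$ exists, and $p(j)=a(k_1;n)/p(k_1)$). The active set $H_{(m-1)^4,\,m^4}$ is the set of all defining elements $a(k_1;n)>p(k_1)^2$ of row $k_1$ whose transition row $j$ satisfies either $a(k_1;n)<m^4<p(j)^2<(m+1)^4$ or $m^4<a(k_1;n)<p(j)^2<(m+1)^4$. *)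

(* Defs.v *)
From mathcomp Require Import all_boot.
From mathcomp Require Import classical_sets.

Set Implicit Arguments.
Unset Strict Implicit.
Unset Printing Implicit Defensive.

Local Open Scope classical_set_scope.

Lemma next_prime_exists (m : nat) : exists q, (m < q) && prime q.
Proof. by have [q lt_mq pr_q] := prime_above m; exists q; apply/andP. Qed.

Definition next_prime (m : nat) : nat := ex_minn (next_prime_exists m).

(* Primes are numbered from 1, i.e. ith_prime 1 = 2; the value 0 at index 0
   only serves to start the iteration. *)
Definition ith_prime (i : nat) : nat := iter i next_prime 0.

(* Rows k and columns n of the T-matrix are also numbered from 1, so every
   index below carries a bound 1 <= _ (or 1 < _), explicit or implied. *)
Definition row_prime (k : nat) : nat := ith_prime (k + 2).

Definition entry (k n : nat) : nat :=
  row_prime k * (5 + 2 * (n %/ 2) + 4 * ((n - 1) %/ 2)).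

Definition defining (e : nat) : Prop :=
  ~~ (5 %| e) /\ exists p q : nat, [/\ prime p, prime q & e = p * q].

Definition in_range (m k : nat) : Prop :=
  1 < k /\ (m - 1) ^ 2 < row_prime k < m ^ 2.

Definition is_k1 (m k1 : nat) : Prop :=
  in_range m k1 /\ forall k, in_range m k -> row_prime k <= row_prime k1.

Definition transition_cond (k1 n j : nat) : Prop :=
  [/\ k1 < j,
      entry k1 n < row_prime j ^ 2,
      exists r, [/\ 1 <= r, entry k1 r = row_prime k1 ^ 2
                  & entry j r = entry k1 n]
    & entry j n = row_prime j ^ 2].

(* [unique P j] says that j is the one and only element satisfying P. *)
Definition transition_row (k1 n j : nat) : Prop :=
  unique (transition_cond k1 n) j.

(* The set written H_{(m-1)^4, m^4}. *)
Definition active_set (m : nat) : set nat :=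
  [set e | exists k1 n j : nat,
    [/\ is_k1 m k1, 1 <= n & e = entry k1 n] /\
    [/\ defining e, row_prime k1 ^ 2 < e, transition_row k1 n j
      & [&& e < m ^ 4, m ^ 4 < row_prime j ^ 2
          & row_prime j ^ 2 < (m + 1) ^ 4] \/
        [&& m ^ 4 < e, e < row_prime j ^ 2
          & row_prime j ^ 2 < (m + 1) ^ 4]]].

(* Main.v *)
Require Import Defs.
From mathcomp Require Import all_boot.
From mathcomp Require Import classical_sets.
From mathcomp Require Import zify.

Set Implicit Arguments.
Unset Strict Implicit.

Local Open Scope classical_set_scope.

(** Rows of the matrix are indexed by the primes [p >= 5], columns by the
    integers [c >= 5] coprime to 6, and the entry in row [p], column [c] is
    [p * c].  Every prime from 5 on thus occurs both as the prime of a row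
    ([row_prime_surj]) and as the factor of a column ([column_factor]).  Let
    [p1] be the prime of row [k1].  The conditions on a transition row [j] force
    its prime to be the column factor of the entry, so the entry is [p1 * p] with
    [p] the prime of row [j].

    A prime [p] strictly between [m ^ 2] and [(m + 1) ^ 2] therefore yields the
    entry [p1 * p] of row [k1], which has the row of [p] as transition row
    ([transition_row_prime]).  That entry differs from [m ^ 4], because otherwise
    [p] would divide [m] although [p > m ^ 2]; so one of the two alternatives
    defining the active set holds.  Conversely, both alternatives give
    [m ^ 4 < p ^ 2 < (m + 1) ^ 4] for the prime [p] of the transition row, and
    taking square roots puts [p] in the required interval. *)

Lemma next_primeP m :
  [/\ m < next_prime m, prime (next_prime m)
    & forall q, prime q -> m < q -> next_prime m <= q].
Proof.
rewrite /next_prime; case: ex_minnP => p /andP[ltmp pr_p] min_p.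
by split=> // q pr_q ltmq; apply: min_p; rewrite ltmq.
Qed.

Lemma next_primeE m q : prime q -> m < q ->
  (forall r, m < r < q -> ~~ prime r) -> next_prime m = q.
Proof.
move=> pr_q ltmq gap; have [ltmn pr_n min_n] := next_primeP m.
apply/eqP; rewrite eqn_leq min_n //= leqNgt; apply/negP => ltnq.
by have := gap (next_prime m); rewrite ltmn ltnq pr_n => /(_ isT).
Qed.

Lemma ith_primeS i : ith_prime i.+1 = next_prime (ith_prime i).
Proof. exact: iterS. Qed.

Lemma ith_prime_ltn : {homo ith_prime : i j / i < j}.
Proof.
apply: homo_ltn; first exact: ltn_trans.
by move=> i; rewrite ith_primeS; case: (next_primeP (ith_prime i)).
Qed.

Lemma leq_ith_prime i : i <= ith_prime i.
Proof.
elim: i => // i IHi; exact: leq_ltn_trans IHi (ith_prime_ltn (ltnSn i)).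
Qed.

(** The first index at which the enumeration reaches [q] is the index of [q]:
    one step earlier it is below [q], and the next prime cannot jump over [q]. *)
Lemma ith_prime_surj q : prime q -> exists i, ith_prime i = q.
Proof.
move=> pr_q.
have ex_i : exists i, q <= ith_prime i by exists q; apply: leq_ith_prime.
case: (ex_minnP ex_i) => -[|i] leqi min_i.
  by move: leqi; rewrite leqNgt prime_gt0.
exists i.+1; apply/eqP; rewrite eqn_leq leqi andbT ith_primeS.
have [_ _ min_n] := next_primeP (ith_prime i).
by apply: min_n => //; rewrite ltnNge; apply/negP => /min_i; rewrite ltnn.
Qed.

Lemma row_prime_ltn : {mono row_prime : j k / j < k}.
Proof.
by apply: leqW_mono; apply: leq_mono => j k ltjk;
  apply: ith_prime_ltn; rewrite ltn_add2r.
Qed.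

Lemma row_prime_inj : injective row_prime.
Proof.
move=> j k eqjk; have := row_prime_ltn j k; have := row_prime_ltn k j.
by rewrite eqjk ltnn; lia.
Qed.

Lemma prime_row_prime k : prime (row_prime k).
Proof.
by rewrite /row_prime addnS ith_primeS; case: (next_primeP (ith_prime (k + 1))).
Qed.

Lemma leq_row_prime k : k <= row_prime k.
Proof. exact: leq_trans (leq_addr 2 k) (leq_ith_prime _). Qed.

Lemma row_prime0 : row_prime 0 = 3.
Proof.
rewrite /row_prime /ith_prime /= (@next_primeE 0 2) //; last first.
  by case=> [|[]].
by apply: next_primeE => // -[|[|[|[]]]].
Qed.

Lemma row_prime1 : row_prime 1 = 5.
Proof.
rewrite /row_prime ith_primeS -[ith_prime _]/(row_prime 0) row_prime0.
by apply: next_primeE => // -[|[|[|[|[|[]]]]]].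
Qed.

Lemma row_prime_surj q : prime q -> 3 <= q -> exists k, row_prime k = q.
Proof.
move=> pr_q leq3q; have [i def_q] := ith_prime_surj pr_q.
have le2i : 2 <= i.
  rewrite leqNgt; apply/negP => lti2.
  have := ith_prime_ltn lti2; rewrite -[ith_prime 2]/(row_prime 0) row_prime0.
  by rewrite def_q ltnNge leq3q.
by exists (i - 2); rewrite /row_prime subnK.
Qed.

(** A prime [q >= 5] is [5] or [1] modulo 6, and the odd columns [2 t + 1] carry
    the factors [6 t + 5], the even columns [2 t + 2] the factors [6 t + 7]. *)
Lemma column_factor q : prime q -> 5 <= q ->
  exists2 n, 1 <= n & forall k, entry k n = row_prime k * q.
Proof.
move=> pr_q le5q.
have ndvd d : 1 < d -> d < 5 -> ~~ (d %| q).
  move=> lt1d ltd5; apply/negP => dvdq.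
  by move/primeP: pr_q => [_ /(_ _ dvdq)] /orP[] /eqP; lia.
have := ndvd 2 isT isT; have := ndvd 3 isT isT; rewrite /dvdn => n3 n2.
have [q5|q1] : q %% 6 = 5 \/ q %% 6 = 1 by lia.
  by exists (2 * (q %/ 6) + 1) => [|k]; [|rewrite /entry; congr (_ * _)]; lia.
by exists (2 * (q %/ 6)) => [|k]; [|rewrite /entry; congr (_ * _)]; lia.
Qed.

Lemma in_range_exists m q : 3 <= m -> prime q -> (m - 1) ^ 2 < q < m ^ 2 ->
  exists k, in_range m k.
Proof.
move=> hm pr_q /andP[ltq qlt].
(* For m = 3 the given prime may be 5, the prime of the excluded row 1; then 7
   serves instead. *)
have [q' [pr_q' lt5q' range_q']] :
    exists q', [/\ prime q', 5 < q' & (m - 1) ^ 2 < q' < m ^ 2].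
  have [m3|m4] : m = 3 \/ 4 <= m by lia.
    by exists 7; rewrite m3.
  by exists q; split; [|nia|rewrite ltq].
have [k def_q'] := row_prime_surj pr_q' (ltn_trans (isT : 2 < 5) lt5q').
exists k; split; last by rewrite def_q'.
by rewrite -row_prime_ltn row_prime1 def_q'.
Qed.

Lemma is_k1_exists m k : in_range m k -> exists k1, is_k1 m k1.
Proof.
pose P k := (1 < k) && ((m - 1) ^ 2 < row_prime k < m ^ 2).
have PP i : reflect (in_range m i) (P i) by apply: andP.
move=> /PP Pk; have exP : exists k, P k by exists k.
have boundP i : P i -> i <= m ^ 2.
  by case/and3P=> _ _ lti; apply: leq_trans (leq_row_prime i) (ltnW lti).
case: (ex_maxnP exP boundP) => k1 /PP Pk1 max_k1.
exists k1; split=> // i /PP /max_k1.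
by rewrite leqNgt -row_prime_ltn -leqNgt.
Qed.

(** The diagonal condition on a row [i] reads [row_prime i * q = row_prime i ^ 2],
    where [q] is the factor of column [n]; hence row [i] is the row of [q]. *)
Lemma transition_row_prime k1 j n : 1 <= k1 -> k1 < j ->
  (forall k, entry k n = row_prime k * row_prime j) ->
  transition_row k1 n j.
Proof.
move=> k1_gt0 lt_k1j entry_n.
have lt_p1p : row_prime k1 < row_prime j by rewrite row_prime_ltn.
have le5p1 : 5 <= row_prime k1.
  by rewrite -row_prime1 leqNgt row_prime_ltn -leqNgt.
split.
  have [r r_gt0 entry_r] := column_factor (prime_row_prime k1) le5p1.
  split=> //; first by rewrite entry_n; nia.
  by exists r; rewrite !entry_r entry_n mulnn mulnC.
move=> i [_ _ _]; rewrite entry_n -mulnn => /eqP.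
rewrite eqn_pmul2l ?prime_gt0 ?prime_row_prime // => /eqP.
exact: row_prime_inj.
Qed.

Unset Implicit Arguments.
Set Strict Implicit.

Theorem mainTheorem2 (m : nat) (hm : 3 <= m)
  (hprime : exists q : nat, prime q /\ (m - 1) ^ 2 < q < m ^ 2) :
  (exists p : nat, prime p /\ m ^ 2 < p < (m + 1) ^ 2) <->
  active_set m !=set0.
Proof.
have pow4 x : x ^ 4 = (x ^ 2) ^ 2 by rewrite -expnM.
have lt_sqr x y : (x ^ 2 < y ^ 2) = (x < y) by rewrite ltn_exp2r.
split; last first.
  case=> e [k1 [n [j [_ [_ _ _ bounds]]]]].
  exists (row_prime j); split; first exact: prime_row_prime.
  rewrite -(lt_sqr (m ^ 2)) -(lt_sqr (row_prime j)) -!pow4.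
  by case: bounds => /and3P[lt1 lt2 ->]; rewrite ?lt2 // (ltn_trans lt1 lt2).
case=> p [pr_p /andP[ltp plt]].
case: hprime => q [pr_q range_q].
have [k /is_k1_exists[k1 k1P]] := in_range_exists hm pr_q range_q.
have [[lt1k1 /andP[_ p1lt]] _] := k1P.
have le9m2 : 3 ^ 2 <= m ^ 2 by rewrite leq_exp2r.
have le5p : 5 <= p by lia.
have [j def_p] := row_prime_surj pr_p (leq_trans (isT : 3 <= 5) le5p).
have [n n_gt0 entry_n] := column_factor pr_p le5p.
have pr_p1 := prime_row_prime k1.
have lt_p1p : row_prime k1 < p by apply: ltn_trans p1lt ltp.
have lt5p1 : 5 < row_prime k1 by rewrite -row_prime1 row_prime_ltn.
have lt_k1j : k1 < j by rewrite -row_prime_ltn def_p.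
exists (entry k1 n), k1, n, j; split; first by split.
split.
- split; last by exists (row_prime k1), p; rewrite entry_n.
  rewrite entry_n Euclid_dvdM // !dvdn_prime2 //; lia.
- by rewrite entry_n -mulnn ltn_pmul2l ?prime_gt0.
- by apply: transition_row_prime => [|//|]; [exact: ltnW|rewrite def_p].
have e_neq : entry k1 n != m ^ 4.
  rewrite entry_n; apply/eqP => eq_e.
  have : p %| m ^ 4 by rewrite -eq_e dvdn_mull.
  rewrite Euclid_dvdX // andbT => /dvdn_leq; nia.
have e_lt : entry k1 n < p ^ 2.
  by rewrite entry_n -mulnn ltn_pmul2r ?prime_gt0.
have m4_lt : m ^ 4 < p ^ 2 by rewrite pow4 lt_sqr.
have p2_lt : p ^ 2 < (m + 1) ^ 4 by rewrite pow4 lt_sqr.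
rewrite def_p m4_lt e_lt p2_lt !andbT.
by apply/orP; rewrite -neq_ltn.
Qed.
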